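(* For any prime number $p$ and any positive integer $n$, $$\rho(\mathrm{Tr}(\mathrm{Sub}(C_p^n)))=\frac{\sum_{i=0}^{n-1}\sum_{j=1}^{n-i}\sum_{k=0}^{n-i-j}\binom{n}{i}_p\binom{n-i}{j}_p\binom{n-i-j}{k}_p\,(a_{j+k}-a_k)}{\left(\sum_{i=0}^{n-1}\binom{n}{i}_p(a_{n-i}-1)\right)^2},$$ where $\binom{n}{d}_p$ denotes the Gaussian binomial coefficient and $a_d=\sum_{i=0}^d\binom{d}{i}_p$. Consequently, for every fixed positive integer $n$, with the limit taken over primes $p$, $$\lim_{p\to\infty}\rho(\mathrm{Tr}(\mathrm{Sub}(C_p^n)))=\begin{cases}1 & n=1\\ 1/4 & n=2\\ 0 & n>2\end{cases}$$ and, for every fixed prime $p$, $$\lim_{n\to\infty}\rho(\mathrm{Tr}(\mathrm{Sub}(C_p^n)))=0.$$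
   Context: $C_p^n$ is the elementary abelian $p$-group of rank $n$, and $\mathrm{Sub}(C_p^n)$ is its subgroup lattice (conjugation action trivial). $\binom{n}{d}_p$ is the number of $d$-dimensional subspaces of $\mathbb{F}_p^n$. A transfer system on a lattice $L$ (with trivial group action) is a partial order $\to$ on the set $L$ such that $x\to y$ implies $x\le y$, and whenever $x\to y$ and $x'\le y$, we have $x\wedge x'\to x'$. $\mathrm{Tr}(L)$ denotes the set of transfer systems on $L$ ordered by inclusion; it is a complete lattice. For a finite lattice $P$ with at least two elements, let $J(P)$ and $M(P)$ be its sets of join-irreducible and meet-irreducible elements (the minimum element is not join-irreducible, and the maximum element is not meet-irreducible); the codensity of $P$ is $$\rho(P)=\frac{|\{(A,B)\in J(P)\times M(P): A\not\le B\}|}{|J(P)|\,|M(P)|}.$$ *)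

(* Defs.v *)
From HB Require Import structures.
From mathcomp Require Import all_boot all_order all_fingroup all_algebra all_character.

Set Implicit Arguments.
Unset Strict Implicit.
Unset Printing Implicit Defensive.

Import Order.TTheory GRing.Theory Num.Theory.

Fact inclusion_display : Order.disp_t. Proof. exact: Order.Disp tt tt. Qed.

Section SubgroupLattice.
Variable gT : finGroupType.
Implicit Types G H K : {group gT}.

(* All subgroups of gT; an alias of {group gT}, on which MathComp puts no
   order, so as to carry the inclusion order. *)
Definition Subgroups : Type := {group gT}.
HB.instance Definition _ := Finite.on Subgroups.

Let le_sub (G H : Subgroups) : bool := (G \subset H)%g.

Fact le_sub_refl : reflexive le_sub.
Proof. by move=> G; apply: subxx. Qed.

Fact le_sub_anti : antisymmetric le_sub.
Proof. by move=> G H GH; apply/val_inj/eqP; rewrite eqEsubset. Qed.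

Fact le_sub_trans : transitive le_sub.
Proof. by move=> H G K; apply: subset_trans. Qed.

HB.instance Definition _ := Order.Le_isPOrder.Build inclusion_display Subgroups
  le_sub_refl le_sub_anti le_sub_trans.

Fact sub_meetP (G H K : Subgroups) :
  (G <= ((H :&: K)%G : Subgroups))%O = (G <= H)%O && (G <= K)%O.
Proof. exact: subsetI. Qed.

Fact sub_joinP (G H K : Subgroups) :
  (((G <*> H)%G : Subgroups) <= K)%O = (G <= K)%O && (H <= K)%O.
Proof. exact: join_subG. Qed.

HB.instance Definition _ :=
  Order.POrder_MeetJoin_isLattice.Build inclusion_display Subgroups
    sub_meetP sub_joinP.

Fact sub_le0x (G : Subgroups) : ((1%G : Subgroups) <= G)%O.
Proof. exact: sub1G. Qed.

Fact sub_lex1 (G : Subgroups) : (G <= ([set: gT]%G : Subgroups))%O.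
Proof. exact: subsetT. Qed.

HB.instance Definition _ :=
  Order.hasBottom.Build inclusion_display Subgroups sub_le0x.
HB.instance Definition _ :=
  Order.hasTop.Build inclusion_display Subgroups sub_lex1.

End SubgroupLattice.

Section TransferSystems.
Context {d : Order.disp_t} (L : finLatticeType d).
Implicit Types (x y z : L) (t : {set L * L}).
Local Open Scope order_scope.

(* A relation x -> y on L is encoded as its graph, the set of pairs (x, y). *)
Definition transfer_system t : bool :=
  [&& [forall x, (x, x) \in t],
      [forall x, forall y, ((x, y) \in t) && ((y, x) \in t) ==> (x == y)],
      [forall x, forall y, forall z,
         ((x, y) \in t) && ((y, z) \in t) ==> ((x, z) \in t)],
      [forall x, forall y, ((x, y) \in t) ==> (x <= y)] &
      [forall x, forall y, forall x',
         ((x, y) \in t) && (x' <= y) ==> ((x `&` x', x') \in t)]].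

Lemma transfer_systemP t :
  reflect
    [/\ forall x, (x, x) \in t,
        forall x y, (x, y) \in t -> (y, x) \in t -> x = y,
        forall x y z, (x, y) \in t -> (y, z) \in t -> (x, z) \in t,
        forall x y, (x, y) \in t -> x <= y &
        forall x y x', (x, y) \in t -> x' <= y -> (x `&` x', x') \in t]
    (transfer_system t).
Proof.
apply: (iffP and5P) => -[r a tr le re]; split.
- by move=> x; apply: (forallP r).
- move=> x y xy yx; apply/eqP.
  by move/forallP/(_ x)/forallP/(_ y)/implyP: a; apply; rewrite xy.
- move=> x y z xy yz.
  by move/forallP/(_ x)/forallP/(_ y)/forallP/(_ z)/implyP: tr; apply; rewrite xy.
- by move=> x y; apply/implyP; move/forallP/(_ x)/forallP/(_ y): le.
- move=> x y x' xy x'y.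
  by move/forallP/(_ x)/forallP/(_ y)/forallP/(_ x')/implyP: re; apply; rewrite xy.
- by apply/forallP.
- apply/forallP => x; apply/forallP => y; apply/implyP => /andP[xy yx].
  by rewrite (a x y).
- apply/forallP => x; apply/forallP => y; apply/forallP => z.
  by apply/implyP => /andP[xy yz]; apply: tr xy yz.
- by apply/forallP => x; apply/forallP => y; apply/implyP; apply: le.
- apply/forallP => x; apply/forallP => y; apply/forallP => x'.
  by apply/implyP => /andP[xy x'y]; apply: re xy x'y.
Qed.

Record Tr : Type := MkTr { tr_val :> {set L * L}; _ : transfer_system tr_val }.
HB.instance Definition _ := [isSub for tr_val].
HB.instance Definition _ := [Finite of Tr by <:].

Implicit Types A B C : Tr.

Let le_tr A B : bool := tr_val A \subset tr_val B.

Fact le_tr_refl : reflexive le_tr.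
Proof. by move=> A; apply: subxx. Qed.

Fact le_tr_anti : antisymmetric le_tr.
Proof. by move=> A B AB; apply/val_inj/eqP; rewrite eqEsubset. Qed.

Fact le_tr_trans : transitive le_tr.
Proof. by move=> B A C; apply: subset_trans. Qed.

HB.instance Definition _ := Order.Le_isPOrder.Build inclusion_display Tr
  le_tr_refl le_tr_anti le_tr_trans.

Fact transfer_system_bot : transfer_system [set u : L * L | u.1 == u.2].
Proof.
apply/transfer_systemP; split=> [x|x y|x y z|x y|x y x']; rewrite !inE //=.
- by move=> /eqP.
- by move=> /eqP->.
- by move=> /eqP->.
- by move=> /eqP-> /meet_idPl; rewrite meetC => ->.
Qed.

Fact transfer_system_top : transfer_system [set u : L * L | u.1 <= u.2].
Proof.
apply/transfer_systemP; split=> [x|x y|x y z|x y|x y x']; rewrite !inE //=.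
- by move=> xy yx; apply: le_anti; rewrite xy.
- exact: le_trans.
- by move=> _ _; apply: leIr.
Qed.

Fact transfer_system_bigcap (P : pred Tr) (A0 : Tr) :
  P A0 -> transfer_system (\bigcap_(A | P A) tr_val A).
Proof.
move=> PA0; apply/transfer_systemP; split.
- move=> x; apply/bigcapP => A _.
  by have /transfer_systemP[r _ _ _ _] := valP A; apply: r.
- move=> x y /bigcapP/(_ _ PA0) xy /bigcapP/(_ _ PA0) yx.
  by have /transfer_systemP[_ a _ _ _] := valP A0; apply: a.
- move=> x y z /bigcapP xy /bigcapP yz; apply/bigcapP => A PA.
  have /transfer_systemP[_ _ tr _ _] := valP A.
  exact: tr (xy _ PA) (yz _ PA).
- move=> x y /bigcapP/(_ _ PA0) xy.
  by have /transfer_systemP[_ _ _ le _] := valP A0; apply: le.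
- move=> x y x' /bigcapP xy x'y; apply/bigcapP => A PA.
  have /transfer_systemP[_ _ _ _ re] := valP A.
  exact: re (xy _ PA) x'y.
Qed.

Fact transfer_system_setI A B : transfer_system (tr_val A :&: tr_val B).
Proof.
have := @transfer_system_bigcap (pred2 A B) A (predU1l _ erefl).
suff -> : \bigcap_(C | pred2 A B C) tr_val C = tr_val A :&: tr_val B by [].
apply/setP => u; rewrite inE; apply/bigcapP/andP => [h|[uA uB] C].
  by split; apply: h; rewrite /= eqxx ?orbT.
by move=> /pred2P[] ->.
Qed.

Definition tr_bot : Tr := MkTr transfer_system_bot.
Definition tr_top : Tr := MkTr transfer_system_top.

Fact tr_lex1 A : A <= tr_top.
Proof.
apply/subsetP => -[x y] xy; rewrite inE /=.
by have /transfer_systemP[_ _ _ le _] := valP A; apply: le.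
Qed.

Fact tr_le0x A : tr_bot <= A.
Proof.
apply/subsetP => -[x y]; rewrite inE /= => /eqP->.
by have /transfer_systemP[r _ _ _ _] := valP A; apply: r.
Qed.

Fact transfer_system_join A B :
  transfer_system (\bigcap_(C : Tr | (A <= C) && (B <= C)) tr_val C).
Proof. by apply: (@transfer_system_bigcap _ tr_top); rewrite !tr_lex1. Qed.

Definition tr_meet A B : Tr := MkTr (transfer_system_setI A B).

(* The union of two transfer systems need not be one. *)
Definition tr_join A B : Tr := MkTr (transfer_system_join A B).

Fact tr_meetP A B C : (A <= tr_meet B C) = (A <= B) && (A <= C).
Proof. exact: subsetI. Qed.

Fact tr_joinP A B C : (tr_join A B <= C) = (A <= C) && (B <= C).
Proof.
apply/idP/idP => [le_jC|AB_C]; last exact: (bigcap_inf C).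
by apply/andP; split; apply: le_trans le_jC; apply/bigcapsP => D /andP[].
Qed.

HB.instance Definition _ :=
  Order.POrder_MeetJoin_isLattice.Build inclusion_display Tr
    tr_meetP tr_joinP.
HB.instance Definition _ :=
  Order.hasBottom.Build inclusion_display Tr tr_le0x.
HB.instance Definition _ :=
  Order.hasTop.Build inclusion_display Tr tr_lex1.

End TransferSystems.

Arguments Tr {d} L.

Section Codensity.
Context {d : Order.disp_t} (P : finTBLatticeType d).
Implicit Types x a b : P.
Local Open Scope order_scope.

Definition join_irreducible x : bool :=
  (x != \bot) &&
  [forall a, forall b, (a `|` b == x) ==> (a == x) || (b == x)].

Definition meet_irreducible x : bool :=
  (x != \top) &&
  [forall a, forall b, (a `&` b == x) ==> (a == x) || (b == x)].

Definition JI : {set P} := [set x | join_irreducible x].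
Definition MI : {set P} := [set x | meet_irreducible x].

(* Meaningful when P has at least two elements; if P has one element then JI
   and MI are empty and the quotient is 0 by convention. *)
Definition codensity (R : numFieldType) : R :=
  (#|[set u : P * P | [&& u.1 \in JI, u.2 \in MI & ~~ (u.1 <= u.2)%O]]|%:R
     / (#|JI|%:R * #|MI|%:R))%R.

End Codensity.

Arguments JI {d} P.
Arguments MI {d} P.
Arguments codensity {d} P R.

(* C_p^n, for p prime, as the additive group of F_p^n. *)
Definition elem_abelian (p n : nat) : finGroupType := 'rV['F_p]_n.

(* The number of d-dimensional subspaces of F_p^n; rowg A is the row space of
   A as a set of vectors, so each subspace is counted once. *)
Definition gauss_binom (p n d : nat) : nat :=
  #|[set rowg A | A : 'M['F_p]_n & \rank A == d]|.

Definition num_subspaces (p d : nat) : nat :=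
  \sum_(0 <= i < d.+1) gauss_binom p d i.

(* Main.v *)
Require Import Defs.
From mathcomp Require Import all_boot all_order all_fingroup all_algebra all_character.
From mathcomp Require Import all_classical all_reals all_analysis.
From mathcomp Require Import zify ring lra.

Set Implicit Arguments.
Unset Strict Implicit.
Unset Printing Implicit Defensive.

Import Order.TTheory GRing.Theory Num.Theory.
Import numFieldNormedType.Exports.

(** Transfer systems on a finite lattice L are the right classes of weak
    factorization systems on L, and the whole computation rests on reading
    irreducibility through the lifting relation.

    For x < y, the transfer system [tr_gen x y] generated by x -> y adds to the
    identities only the restrictions of x -> y, and deleting x -> y itself
    leaves a transfer system; hence it is join-irreducible.  As each transfer
    system is the join of the ones generated by its members, these are all the
    join-irreducibles ([JI_Tr]).  Dually, for a < b, [tr_lift a b] consists of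
    the x -> y against which a -> b lifts: whenever a <= x and b <= y, also
    b <= x.  Anything strictly larger contains a -> b, so it is
    meet-irreducible, and factoring x -> y as x <= z -> y with z minimal shows
    that each transfer system is an intersection of such systems
    ([tr_separate], [MI_Tr]).  Now [tr_gen x y] is not below [tr_lift a b]
    exactly when a <= x, b <= y and b is not below x, so the codensity is the
    number of these unlifted squares divided by the square of the number of
    pairs x < y ([codensity_Tr]).

    For subspaces of F_p^n both counts are sums over flags, because an interval
    of length m in the lattice of subspaces looks like the lattice of subspaces
    of F_p^m ([card_sub_interval]).  A square is found by choosing a, then
    b > a, then y >= b, and last x among the subspaces between a and y that do
    not contain b.  This is the closed formula.

    For the limits, the Gaussian binomial (m choose d)_p lies between
    p^(d(m-d)) and 2^d p^(d(m-d)).  Each summand of the numerator then has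
    order at most p^(n^2/2), while the denominator, bounded below by the flags
    whose three steps are as equal as possible, has order at least
    p^(2 floor(n^2/3)).  The outcome is a bound 64^n / p^floor(n^2/6) for the
    codensity ([codensity_le]), which goes to 0 when p is fixed and n grows, and
    when n >= 3 is fixed and p grows.  For n = 1 and n = 2 the formula is
    evaluated. *)

(** * Irreducible transfer systems on a finite lattice *)

Section IrreducibleTransferSystems.
Context {d : Order.disp_t} (L : finLatticeType d).
Implicit Types (a b x y u v z : L) (A B C : Tr L).
Local Open Scope order_scope.

Lemma tr_refl A x : (x, x) \in tr_val A.
Proof. by have /transfer_systemP[r _ _ _ _] := valP A; apply: r. Qed.

Lemma tr_trans A x y z :
  (x, y) \in tr_val A -> (y, z) \in tr_val A -> (x, z) \in tr_val A.
Proof. by have /transfer_systemP[_ _ t _ _] := valP A; apply: t. Qed.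

Lemma tr_le A x y : (x, y) \in tr_val A -> x <= y.
Proof. by have /transfer_systemP[_ _ _ l _] := valP A; apply: l. Qed.

Lemma tr_restr A x y z :
  (x, y) \in tr_val A -> z <= y -> (x `&` z, z) \in tr_val A.
Proof. by have /transfer_systemP[_ _ _ _ re] := valP A; apply: re. Qed.

Lemma le_trP A B : reflect {subset tr_val A <= tr_val B} (A <= B).
Proof. exact: fintype.subsetP. Qed.

Definition gen_set x y : {set L * L} :=
  [set u | (u.1 == u.2) || (u.2 <= y) && (u.1 == x `&` u.2)].

Fact gen_transfer x y : transfer_system (gen_set x y).
Proof.
apply/transfer_systemP; split=> [u|u v|u v w|u v|u v z]; rewrite !inE /=.
- by rewrite eqxx.
- move=> /orP[/eqP-> //|/andP[_ /eqP uE]] /orP[/eqP-> //|/andP[_ /eqP vE]].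
  apply: le_anti; apply/andP; split; first by rewrite uE leIr.
  by rewrite vE leIr.
- move=> /orP[/eqP-> //|/andP[vy /eqP uE]].
  move=> /orP[/eqP<-|/andP[wy /eqP vE]]; first by rewrite vy uE eqxx orbT.
  by rewrite wy uE vE meetA meetxx eqxx orbT.
- by move=> /orP[/eqP-> //|/andP[_ /eqP->]]; apply: leIr.
- move=> /orP[/eqP-> zv|/andP[vy /eqP uE] zv].
    by move/meet_idPr: zv => ->; rewrite eqxx.
  rewrite (le_trans zv vy) uE -meetA (_ : v `&` z = z) ?eqxx ?orbT //.
  exact/meet_idPr.
Qed.

Definition tr_gen x y : Tr L := MkTr (gen_transfer x y).

Lemma mem_gen x y : x <= y -> (x, y) \in tr_val (tr_gen x y).
Proof. by move=> /meet_idPl xy; rewrite inE /= lexx xy eqxx orbT. Qed.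

Lemma gen_leE A x y : x <= y -> (tr_gen x y <= A) = ((x, y) \in tr_val A).
Proof.
move=> xy; apply/le_trP/idP => [|xyA [u v]]; first by apply; apply: mem_gen.
rewrite inE /= => /orP[/eqP->|/andP[vy /eqP->]]; first exact: tr_refl.
exact: tr_restr xyA vy.
Qed.

Lemma gen_inj x y x' y' :
  x < y -> x' < y' -> tr_gen x y = tr_gen x' y' -> (x, y) = (x', y').
Proof.
move=> xy x'y' E.
have := mem_gen (ltW xy); rewrite E inE /= lt_eqF //= => /andP[yy' /eqP xE].
have := mem_gen (ltW x'y'); rewrite -E inE /= lt_eqF //= => /andP[y'y _].
have yE : y = y' by apply: le_anti; rewrite yy'.
by rewrite xE -yE (meet_idPl _) // yE ltW.
Qed.

(** The arrow x -> y of [tr_gen x y] is neither a composite nor a restriction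
    of other arrows, so the lattice element [tr_gen x y] has a unique lower
    cover, obtained by deleting it. *)
Fact gen_strict_transfer x y :
  x < y -> transfer_system (gen_set x y :\ (x, y)).
Proof.
move=> xy; have /transfer_systemP[r a t l re] := gen_transfer x y.
have neq u : (u, u) != (x, y).
  by apply/eqP => -[-> E]; rewrite E ltxx in xy.
apply/transfer_systemP; split=> [u|u v|u v w|u v|u v z].
- by rewrite in_setD1 neq r.
- by move=> /setD1P[_ uv] /setD1P[_ vu]; apply: a.
- move=> /setD1P[nuv uv] /setD1P[nvw vw]; rewrite in_setD1 (t u v w) // andbT.
  apply/eqP => -[uE wE]; move: nuv nvw uv vw; rewrite {}uE {}wE => nxv nvy _.
  rewrite inE /= lexx /= => /orP[/eqP vy|/eqP vE].
    by rewrite vy eqxx in nxv.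
  by move: nvy; rewrite vE (meet_idPl (ltW xy)) eqxx.
- by move=> /setD1P[_ uv]; apply: l.
- move=> /setD1P[nuv uv] zv; rewrite in_setD1 (re u v z) // andbT.
  apply/eqP => -[uzE zE]; move: uv nuv; rewrite inE /= => /orP[/eqP uE|].
    by move: uzE; rewrite uE (meet_idPr zv) zE => E; rewrite E ltxx in xy.
  move=> /andP[vy /eqP uE]; have vE : v = y by apply: le_anti; rewrite vy -zE.
  by rewrite uE vE (meet_idPl (ltW xy)) eqxx.
Qed.

Lemma gen_join_irreducible x y : x < y -> join_irreducible (tr_gen x y).
Proof.
move=> xy; pose D := MkTr (gen_strict_transfer xy); apply/andP; split.
  apply/eqP => E; have := mem_gen (ltW xy).
  by rewrite E inE /= lt_eqF.
apply/forallP => A; apply/forallP => B; apply/implyP => /eqP AB.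
have xyAB : (x, y) \notin tr_val D by rewrite !inE eqxx.
have sub C : C <= tr_gen x y -> (C == tr_gen x y) || (C <= D).
  move=> Cgen; have [xyC|xyC] := boolP ((x, y) \in tr_val C).
    by rewrite eq_le Cgen gen_leE ?xyC // ltW.
  apply/orP; right; apply/le_trP => w wC; rewrite in_setD1 (le_trP _ _ Cgen) //.
  by rewrite andbT; apply: contraNneq xyC => <-.
have /orP[->//|AD] : (A == tr_gen x y) || (A <= D).
  by apply: sub; rewrite -AB leUl.
have /orP[->|BD] : (B == tr_gen x y) || (B <= D).
- by apply: sub; rewrite -AB leUr.
- by rewrite orbT.
by move: xyAB; rewrite -(gen_leE _ (ltW xy)) -AB leUx AD BD.
Qed.

(** The definition of irreducibility speaks of binary joins; this extends it to
    finite ones, the empty join being excluded by the condition on bottom. *)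
Lemma join_irreducible_bigjoin {d' : Order.disp_t}
    (T : finTBLatticeType d') (I : finType)
    (P : pred I) (F : I -> T) (t : T) :
  join_irreducible t -> t = \join_(i | P i) F i ->
  exists2 i, P i & t = F i.
Proof.
move=> /andP[t0 tirr] tE.
have [/existsP[i /andP[Pi /eqP ti]]|/existsPn noF] :=
  boolP [exists i, P i && (t == F i)]; first by exists i.
suff /eqP : \join_(i | P i) F i != t by rewrite -tE.
apply: (big_ind (fun w => w != t)) => [|v w vt wt|i Pi].
- by rewrite eq_sym.
- apply: contraNneq vt => vw.
  by have /forallP/(_ v)/forallP/(_ w) := tirr; rewrite vw eqxx (negPf wt) orbF.
- by have := noF i; rewrite Pi /= eq_sym.
Qed.

Lemma join_irreducible_gen A :
  join_irreducible A -> exists2 w, w.1 < w.2 & A = tr_gen w.1 w.2.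
Proof.
move=> Airr; pose P w := (w \in tr_val A) && (w.1 < w.2).
have AE : A = \join_(w | P w) tr_gen w.1 w.2.
  apply: le_anti; apply/andP; split.
    apply/le_trP => -[x y] xyA; have := tr_le xyA.
    rewrite le_eqVlt => /predU1P[->|xy]; first exact: tr_refl.
    rewrite -(gen_leE _ (ltW xy)).
    by apply: (@joins_sup _ _ _ (x, y)); rewrite /P xyA.
  by apply/joinsP => -[x y] /andP[/= xyA xy]; rewrite (gen_leE _ (ltW xy)).
by have [w /andP[_ ?]] := join_irreducible_bigjoin Airr AE; exists w.
Qed.

(** The maps x -> y with the right lifting property against a -> b: in a poset,
    a commutative square is a pair of inequalities a <= x and b <= y, and a
    filler is the inequality b <= x. *)
Definition lift_set a b : {set L * L} :=
  [set u | (u.1 <= u.2) && ((a <= u.1) && (b <= u.2) ==> (b <= u.1))].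

Fact lift_transfer a b : transfer_system (lift_set a b).
Proof.
apply/transfer_systemP; split=> [u|u v|u v w|u v|u v z]; rewrite !inE /=.
- by rewrite lexx; apply/implyP => /andP[].
- by move=> /andP[uv _] /andP[vu _]; apply: le_anti; rewrite uv.
- move=> /andP[uv luv] /andP[vw lvw]; rewrite (le_trans uv vw) /=.
  apply/implyP => /andP[au bw]; apply: (implyP luv); rewrite au /=.
  by apply: (implyP lvw); rewrite (le_trans au uv).
- by case/andP.
- move=> /andP[uv luv] zv; rewrite leIr /= !lexI.
  apply/implyP => /andP[/andP[au az] bz]; rewrite bz andbT.
  by apply: (implyP luv); rewrite au (le_trans bz zv).
Qed.

Definition tr_lift a b : Tr L := MkTr (lift_transfer a b).

Lemma mem_lift a b x y : x <= y ->
  ((x, y) \in tr_val (tr_lift a b)) = ~~ [&& a <= x, b <= y & ~~ (b <= x)].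
Proof. by move=> xy; rewrite inE /= xy /= implybE !negb_and negbK orbA. Qed.

Lemma notin_lift a b : a < b -> (a, b) \notin tr_val (tr_lift a b).
Proof. by move=> ab; rewrite (mem_lift _ _ (ltW ab)) !lexx negbK /= lt_geF. Qed.

Lemma lift_inj a b a' b' :
  a < b -> a' < b' -> tr_lift a b = tr_lift a' b' -> (a, b) = (a', b').
Proof.
move=> ab a'b' E.
have := notin_lift ab; rewrite E (mem_lift _ _ (ltW ab)) negbK => /and3P[a'a b'b _].
have := notin_lift a'b'; rewrite -E (mem_lift _ _ (ltW a'b')) negbK => /and3P[aa' bb' _].
by rewrite (@le_anti _ _ a a') ?aa' ?a'a // (@le_anti _ _ b b') ?bb' ?b'b.
Qed.

(** An arrow x -> y against which a -> b does not lift restricts along b <= y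
    to meet(x, b) -> b.  Since b is not below x, the map a -> b lifts vacuously
    against a -> meet(x, b), and the composite of these two arrows is
    a -> b. *)
Lemma mem_of_lift_lt A a b : a < b ->
  tr_lift a b < A -> (a, b) \in tr_val A.
Proof.
move=> ab; rewrite lt_neqAle => /andP[neq /le_trP sub].
have /subsetPn[[x y] xyA] : ~~ (tr_val A \subset tr_val (tr_lift a b)).
  apply: contra neq => subA; rewrite eq_le; apply/andP; split=> //.
  exact/le_trP.
rewrite mem_lift ?(tr_le xyA) // negbK => /and3P[ax bey nbx].
have xbA := tr_restr xyA bey; apply: tr_trans xbA; apply: sub.
by rewrite mem_lift lexI ?ax ?(ltW ab) // (negPf nbx) andbF.
Qed.

Lemma lift_meet_irreducible a b : a < b -> meet_irreducible (tr_lift a b).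
Proof.
move=> ab; apply/andP; split.
  apply/eqP => E; have := notin_lift ab.
  by rewrite E inE /= ltW.
apply/forallP => A; apply/forallP => B; apply/implyP => /eqP AB.
apply: contraNT (notin_lift ab); rewrite negb_or => /andP[nA nB].
have abA C : tr_lift a b <= C -> C != tr_lift a b -> (a, b) \in tr_val C.
  by move=> le ne; apply: mem_of_lift_lt => //; rewrite lt_neqAle eq_sym ne.
rewrite -AB inE; apply/andP; split; apply: abA => //.
- by rewrite -AB leIl.
- by rewrite -AB leIr.
Qed.

(** The factorization of x <= y through x <= z followed by z -> y in A, with z
    minimal.  Minimality makes x -> z lift against every u -> v of A: the
    restriction of u -> v along z <= v is an arrow meet(u, z) -> z, so
    meet(u, z) is another candidate for z. *)
Lemma tr_separate A x y : x <= y -> (x, y) \notin tr_val A ->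
  exists2 z, x < z & A <= tr_lift x z /\ (x, y) \notin tr_val (tr_lift x z).
Proof.
move=> xy xyA; pose P z := (x <= z) && ((z, y) \in tr_val A).
have Py : P y by rewrite /P xy tr_refl.
(* The number of elements below z stands in for a linear extension of the
   order, and turns minimality into a numerical condition. *)
pose z := [arg min_(z < y | P z) #|[set w | (w <= z)%O]|]%N.
have [Pz zmin] : P z /\ forall w, P w -> w <= z -> w = z.
  rewrite /z; case: arg_minnP => // {}z Pz zmin; split=> // w Pw wz.
  have sub : [set u | u <= w] \subset [set u | u <= z].
    by apply/fintype.subsetP => u; rewrite !inE => /le_trans; apply.
  have /eqP/setP/(_ z) : [set u | u <= w] == [set u | u <= z].
    by rewrite eqEcard sub zmin.
  by rewrite !inE lexx => zw; apply: le_anti; rewrite wz zw.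
have /andP[xz zyA] := Pz; have zy := tr_le zyA.
have nxz : x != z by apply: contraNneq xyA => ->.
have xltz : x < z by rewrite lt_neqAle nxz.
exists z => //; split; last by rewrite mem_lift // negbK lexx zy lt_geF.
apply/le_trP => -[u v] uvA; rewrite mem_lift ?(tr_le uvA) //.
apply/negP => /and3P[xu zv /negP[]].
have uzA := tr_restr uvA zv.
rewrite -(zmin (u `&` z)) ?leIl ?leIr // /P lexI xu xz /=.
exact: tr_trans uzA zyA.
Qed.

Lemma meet_irreducible_bigmeet {d' : Order.disp_t}
    (T : finTBLatticeType d') (I : finType) (P : pred I) (F : I -> T) (t : T) :
  meet_irreducible t -> t = \meet_(i | P i) F i ->
  exists2 i, P i & t = F i.
Proof.
move=> /andP[t0 tirr] tE.
have [/existsP[i /andP[Pi /eqP ti]]|/existsPn noF] :=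
  boolP [exists i, P i && (t == F i)]; first by exists i.
suff /eqP : \meet_(i | P i) F i != t by rewrite -tE.
apply: (big_ind (fun w => w != t)) => [|v w vt wt|i Pi].
- by rewrite eq_sym.
- apply: contraNneq vt => vw.
  by have /forallP/(_ v)/forallP/(_ w) := tirr; rewrite vw eqxx (negPf wt) orbF.
- by have := noF i; rewrite Pi /= eq_sym.
Qed.

Lemma meet_irreducible_lift A :
  meet_irreducible A -> exists2 w, w.1 < w.2 & A = tr_lift w.1 w.2.
Proof.
move=> Airr; pose P (w : L * L) := (w.1 < w.2) && (A <= tr_lift w.1 w.2).
have AE : A = \meet_(w | P w) tr_lift w.1 w.2.
  apply: le_anti; apply/andP; split.
    by apply/meetsP => w /andP[].
  apply/le_trP => -[x y]; apply: contraTT => xyA.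
  have [xy|nxy] := boolP (x <= y); last by apply: contra nxy => /tr_le.
  have [z xz [Az xyz]] := tr_separate xy xyA.
  apply: contra xyz; apply/le_trP.
  by apply: (@meets_inf _ _ _ (x, z)); rewrite /P /= xz.
by have [w /andP[? _]] := meet_irreducible_bigmeet Airr AE; exists w.
Qed.

Lemma JI_Tr : JI (Tr L) = [set tr_gen w.1 w.2 | w : L * L & w.1 < w.2].
Proof.
apply/setP => A; rewrite inE; apply/idP/imsetP => [/join_irreducible_gen[w]|[w]].
  by move=> ? ->; exists w; rewrite ?inE.
by rewrite inE => ? ->; apply: gen_join_irreducible.
Qed.

Lemma MI_Tr : MI (Tr L) = [set tr_lift w.1 w.2 | w : L * L & w.1 < w.2].
Proof.
apply/setP => A; rewrite inE; apply/idP/imsetP => [/meet_irreducible_lift[w]|[w]].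
  by move=> ? ->; exists w; rewrite ?inE.
by rewrite inE => ? ->; apply: lift_meet_irreducible.
Qed.

Definition strict_pairs : {set L * L} := [set w | w.1 < w.2].

(** A member is read as ((x, y), (a, b)), the first pair generating a
    join-irreducible and the second one a meet-irreducible. *)
Definition unlifted_squares : {set (L * L) * (L * L)} :=
  [set q | [&& q.1.1 < q.1.2, q.2.1 < q.2.2,
               q.2.1 <= q.1.1, q.2.2 <= q.1.2 & ~~ (q.2.2 <= q.1.1)]].

Lemma codensity_Tr (R : numFieldType) :
  codensity (Tr L) R = (#|unlifted_squares|%:R / #|strict_pairs|%:R ^+ 2)%R.
Proof.
have gI : {in strict_pairs &, injective (fun w : L * L => tr_gen w.1 w.2)}.
  move=> [x y] [x' y']; rewrite !inE; exact: gen_inj.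
have lI : {in strict_pairs &, injective (fun w : L * L => tr_lift w.1 w.2)}.
  move=> [x y] [x' y']; rewrite !inE; exact: lift_inj.
rewrite /codensity JI_Tr MI_Tr !card_in_imset // expr2; congr (_%:R / _)%R.
pose f (q : (L * L) * (L * L)) := (tr_gen q.1.1 q.1.2, tr_lift q.2.1 q.2.2).
rewrite -(@card_in_imset _ _ f); last first.
  move=> [v w] [v' w']; rewrite !inE => /and5P[? ? _ _ _] /and5P[? ? _ _ _].
  move/eqP; rewrite xpair_eqE => /andP[/eqP/gI E1 /eqP/lI E2].
  by congr (_, _); [apply: E1 | apply: E2]; rewrite inE.
apply: eq_card => -[A B]; rewrite inE /=; apply/and3P/imsetP.
  move=> [/imsetP[v vs ->] /imsetP[w ws ->]].
  move: vs ws; rewrite !inE => vs ws.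
  rewrite (gen_leE _ (ltW vs)) (mem_lift _ _ (ltW vs)) negbK.
  by move=> lft; exists (v, w); rewrite // inE vs ws.
move=> [[v w]]; rewrite inE /= => /and5P[vs ws h1 h2 h3] [-> ->]; split.
- by apply: imset_f; rewrite inE.
- by apply: imset_f; rewrite inE.
- by rewrite (gen_leE _ (ltW vs)) (mem_lift _ _ (ltW vs)) negbK h1 h2.
Qed.

End IrreducibleTransferSystems.

(** * Counting in a ranked lattice with uniform intervals *)

(** The counts depend only on the rank function and on the fact that the number
    of elements of given rank in an interval depends on its length alone. *)
Section UniformIntervals.
Context {d : Order.disp_t} (L : finTBLatticeType d) (R : numFieldType).
Variables (dim : L -> nat) (N : nat -> nat -> nat).
Implicit Types (a b x y z : L).
Local Open Scope ring_scope.

Hypothesis dim_lt : forall x y, (x < y)%O -> (dim x < dim y)%N.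
Hypothesis dim_bot : dim \bot%O = 0%N.
Hypothesis card_interval_dim : forall x y e, (x <= y)%O ->
  #|[set z | [&& (x <= z)%O, (z <= y)%O & dim z == dim x + e]]|%N =
  N (dim y - dim x)%N e.

Let n := dim \top%O.
Let A m := (\sum_(0 <= i < m.+1) N m i)%N.

Lemma dim_le x y : (x <= y)%O -> (dim x <= dim y)%N.
Proof. by rewrite le_eqVlt => /predU1P[->//|/dim_lt/ltnW]. Qed.

Lemma sum_interval x y (F : nat -> R) : (x <= y)%O ->
  \sum_(z | (x <= z)%O && (z <= y)%O) F (dim z - dim x)%N =
  \sum_(0 <= e < (dim y - dim x).+1) (N (dim y - dim x) e)%:R * F e.
Proof.
move=> xy; set m := (dim y - dim x)%N.
rewrite (partition_big (fun z => inord (dim z - dim x) : 'I_m.+1) xpredT) //=.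
rewrite big_mkord; apply: eq_bigr => e _.
have PE z : (x <= z)%O && (z <= y)%O && (inord (dim z - dim x) == e :> 'I_m.+1)
    = [&& (x <= z)%O, (z <= y)%O & dim z == dim x + e]%N.
  rewrite -andbA; case xz: (x <= z)%O => //=; case zy: (z <= y)%O => //=.
  have := dim_le zy; have := dim_le xz => dxz dzy.
  rewrite -val_eqE /= inordK; last by rewrite ltnS leq_sub2r.
  by rewrite -(eqn_add2l (dim x)) subnKC.
rewrite (eq_bigl _ _ PE) -card_interval_dim // mulr_natl -sumr_const.
apply: eq_big => [z|z /and3P[_ _ /eqP->]]; first by rewrite inE.
by rewrite addKn.
Qed.

Lemma sum_above x (F : nat -> R) :
  \sum_(z | (x <= z)%O) F (dim z - dim x)%N =
  \sum_(0 <= e < (n - dim x).+1) (N (n - dim x) e)%:R * F e.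
Proof.
rewrite -sum_interval ?lex1 //; apply: eq_bigl => z.
by rewrite lex1 andbT.
Qed.

Lemma card_interval x y : (x <= y)%O ->
  \sum_(z | (x <= z)%O && (z <= y)%O) 1 = (A (dim y - dim x))%:R :> R.
Proof.
move=> xy; rewrite (sum_interval (fun=> 1)) // natr_sum.
by apply: eq_bigr => e _; rewrite mulr1.
Qed.

Lemma card_trivial_interval : A 0 = 1%N.
Proof.
have := card_interval (lexx \bot%O); rewrite subnn.
rewrite (big_pred1 \bot%O) => [|z]; last by rewrite /= -eq_le eq_sym.
by move=> E; apply/eqP; rewrite -(eqr_nat R) -E.
Qed.

Lemma sum_all (F : nat -> R) : F n = 0 ->
  \sum_x F (dim x) = \sum_(0 <= e < n) (N n e)%:R * F e.
Proof.
move=> Fn; have := sum_above \bot%O F.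
rewrite dim_bot subn0 big_nat_recr //= Fn mulr0 addr0 => <-.
by apply: eq_big => [z|z _]; rewrite ?le0x ?subn0.
Qed.

Lemma card_strict_pairs :
  #|strict_pairs L|%:R =
  \sum_(0 <= i < n) (N n i)%:R * ((A (n - i))%:R - 1) :> R.
Proof.
rewrite -(sum_all (F := fun i => (A (n - i))%:R - 1)); last first.
  by rewrite subnn card_trivial_interval subrr.
rewrite -sum1_card natr_sum.
transitivity (\sum_(x : L) \sum_(y : L | (x < y)%O) 1 : R).
  rewrite pair_big_dep /=; apply: eq_bigl => w; by rewrite inE.
apply: eq_bigr => x _; rewrite -card_interval ?lex1 //.
rewrite [X in _ = X - 1](bigD1 x) /=; last first.
  by rewrite lexx lex1.
rewrite addrC addrK; apply: eq_bigl => y.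
by rewrite lex1 andbT lt_neqAle eq_sym andbC.
Qed.

Lemma sum_strictly_above x (F : nat -> R) :
  \sum_(z | (x < z)%O) F (dim z - dim x)%N =
  \sum_(1 <= e < (n - dim x).+1) (N (n - dim x) e)%:R * F e.
Proof.
pose F' e := if e is 0 then 0 else F e.
have := sum_above x F'; rewrite big_ltn //= mulr0 add0r.
rewrite (bigD1 x) //= subnn add0r => E.
transitivity (\sum_(z | (x <= z)%O && (z != x)) F' (dim z - dim x)%N).
  apply: eq_big => [z|z xz]; first by rewrite lt_neqAle eq_sym andbC.
  by have := dim_lt xz; rewrite -subn_gt0; case: (_ - _)%N.
by rewrite E; apply: eq_big_nat => -[].
Qed.

(** An x between a and y that is above b is the same as an x between b and
    y. *)
Lemma sum_escaping a b y : (a <= b)%O -> (b <= y)%O ->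
  \sum_(x | [&& (a <= x)%O, (x <= y)%O & ~~ (b <= x)%O]) 1 =
  (A (dim y - dim a))%:R - (A (dim y - dim b))%:R :> R.
Proof.
move=> ab bey; rewrite -!card_interval ?(le_trans ab) //.
rewrite [X in _ = X - _](bigID (fun x => (b <= x)%O)) /=.
rewrite [X in _ = X + _ - _](eq_bigl (fun x => (b <= x)%O && (x <= y)%O)) => [|x].
  by rewrite addrAC subrr add0r; apply: eq_bigl => x; rewrite andbA.
by case bx: (b <= x)%O; rewrite ?andbF // (le_trans ab bx) andbT.
Qed.

(** The square is chosen in the order a, b, y, x; the ranks of a, of b over a
    and of y over b are the indices i, j and k. *)
Lemma card_unlifted_squares :
  #|unlifted_squares L|%:R =
  \sum_(0 <= i < n) \sum_(1 <= j < (n - i).+1) \sum_(0 <= k < (n - i - j).+1)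
    (N n i)%:R * (N (n - i) j)%:R * (N (n - i - j) k)%:R
      * ((A (j + k))%:R - (A k)%:R) :> R.
Proof.
pose H m j k : R := (N (m - j) k)%:R * ((A (j + k))%:R - (A k)%:R).
pose G m j : R := \sum_(0 <= k < (m - j).+1) H m j k.
pose F i : R := \sum_(1 <= j < (n - i).+1) (N (n - i) j)%:R * G (n - i)%N j.
transitivity (\sum_a F (dim a)).
  transitivity (\sum_(a : L) \sum_(b : L | (a < b)%O) \sum_(y : L | (b <= y)%O)
      \sum_(x : L | [&& (a <= x)%O, (x <= y)%O & ~~ (b <= x)%O]) 1 : R).
    rewrite pair_big_dep pair_big_dep pair_big_dep /=.
    rewrite -sum1_card natr_sum.
    pose h (q : (L * L) * (L * L)) := ((q.2.1, q.2.2, q.1.2), q.1.1).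
    pose h' (q : ((L * L) * L) * L) := ((q.2, q.1.2), (q.1.1.1, q.1.1.2)).
    rewrite (reindex h') /=; last first.
      by exists h => [[[[a b] y] x]|[[x y] [a b]]].
    apply: eq_bigl => -[[[a b] y] x]; rewrite inE /=.
    apply/and5P/andP => [[xy ab ax ->]|].
      by rewrite ax ab => ->; rewrite ltW.
    move=> [/andP[ab bey] /and3P[ax xy nbx]]; split=> //.
    by rewrite lt_neqAle xy andbT; apply: contraNneq nbx => ->.
  apply: eq_bigr => a _; rewrite /F -(sum_strictly_above a (G _)); apply: eq_bigr => b ab.
  have dab := dim_le (ltW ab).
  rewrite /G /H -subnDA subnKC //.
  rewrite -(sum_above b (fun k => (A (dim b - dim a + k))%:R - (A k)%:R)).
  apply: eq_bigr => y bey; rewrite sum_escaping ?(ltW ab) //.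
  by rewrite addnC addnBA // subnK // dim_le.
rewrite sum_all => [|]; last by rewrite /F subnn big_geq.
apply: eq_bigr => i _; rewrite mulr_sumr; apply: eq_bigr => j _.
by rewrite !mulr_sumr; apply: eq_bigr => k _; rewrite /H !mulrA.
Qed.

End UniformIntervals.

(** * Intervals of subgroups of an elementary abelian group *)

Lemma leq_card_imset_factor (T U V : finType) (f : T -> U) (g : T -> V)
    (D : {set T}) :
  {in D &, forall x y, g x = g y -> f x = f y} -> (#|f @: D| <= #|g @: D|)%N.
Proof.
move=> fg; have [->|[x0 x0D]] := set_0Vmem D; first by rewrite !imset0 cards0.
pose s v := odflt x0 [pick x in D | g x == v].
apply: leq_trans (leq_imset_card (f \o s) (g @: D)).
apply/subset_leq_card/fintype.subsetP => _ /imsetP[x xD ->].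
apply/imsetP; exists (g x); first exact: imset_f.
rewrite /= /s; case: pickP => [y /andP[yD /eqP gyx]|/(_ x)]; last first.
  by rewrite xD eqxx.
by apply: fg => //; rewrite gyx.
Qed.

(** Two maps with the same fibres have images of the same size.  It compares
    sets of subspaces of different ambient spaces that are parametrized by the
    same matrices. *)
Lemma eq_card_imset (T U V : finType) (f : T -> U) (g : T -> V)
    (D : {set T}) :
  {in D &, forall x y, f x = f y <-> g x = g y} -> #|f @: D| = #|g @: D|.
Proof.
move=> fg; apply/eqP; rewrite eqn_leq.
by apply/andP; split; apply: leq_card_imset_factor => x y xD yD /fg; apply.
Qed.

Section Subspaces.
Variables p n : nat.
Implicit Types G H X : Subgroups (elem_abelian p n).

Definition sub_dim G : nat := \rank (rowg_mx (G : {set 'rV['F_p]_n})).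

Lemma sub_leE G H :
  (G <= H)%O = (rowg_mx (G : {set 'rV['F_p]_n}) <=
                rowg_mx (H : {set 'rV['F_p]_n}))%MS.
Proof. exact/esym/rowg_mxSK. Qed.

Lemma sub_dim_lt G H : (G < H)%O -> (sub_dim G < sub_dim H)%N.
Proof. by rewrite lt_leAnge !sub_leE => /rank_ltmx. Qed.

Lemma sub_dim_bot : sub_dim \bot%O = 0%N.
Proof. by rewrite /sub_dim rowg_mx1 mxrank0. Qed.

Lemma sub_dim_top : sub_dim \top%O = n.
Proof.
rewrite -[RHS](mxrank1 'F_p n) -(rowgK 1%:M) rowg1; congr (\rank (rowg_mx _)).
Qed.

Lemma rowg_eqP (F : finFieldType) m1 m2 k (A : 'M[F]_(m1, k)) (B : 'M[F]_(m2, k)) :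
  reflect (rowg A = rowg B) (A == B)%MS.
Proof.
apply: (iffP idP) => [/eqmxP/eq_rowg//|E].
by apply/andP; rewrite -!rowgS E.
Qed.

Local Open Scope ring_scope.

(** Let U and W be the subspaces G and H.  With the rows of C a basis of a
    complement of U in W, the map Y |-> U + Y C identifies the row spaces in
    F_p^m with the subspaces between U and W; its inverse sends V to the
    coordinates of the intersection of V with C, by the modular law. *)
Lemma card_sub_interval G H e : (G <= H)%O ->
  #|[set X | [&& (G <= X)%O, (X <= H)%O & sub_dim X == (sub_dim G + e)%N]]| =
  gauss_binom p (sub_dim H - sub_dim G)%N e.
Proof.
rewrite sub_leE => GH; set m := (_ - _)%N.
set U := rowg_mx (G : {set 'rV['F_p]_n}) in GH.
set W := rowg_mx (H : {set 'rV['F_p]_n}) in GH.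
have rC : \rank (W :\: U)%MS = m.
  by rewrite /m /sub_dim -/U -/W -(mxrank_cap_compl W U) (capmx_idPr GH) addKn.
pose C := castmx (rC, erefl n) (row_base (W :\: U)%MS).
have eqC : (C :=: (W :\: U))%MS.
  by apply: eqmx_trans (eqmx_cast _ _) (eq_row_base _).
have Cfree : row_free C by rewrite /row_free eqC rC.
have CU0 : (C :&: U)%MS = 0%R.
  apply/eqP; rewrite -submx0 -(capmx_diff W U); apply: capmxS => //.
  by rewrite eqC.
have UCW : (U + C :=: W)%MS.
  apply/eqmxP/andP; split.
    by rewrite addsmx_sub GH eqC diffmxSl.
  rewrite -(addsmx_diff_cap_eq W U) addsmxC addsmxS ?capmxSr //.
  by rewrite eqC.
pose f (Y : 'M['F_p]_m) : Subgroups (elem_abelian p n) :=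
  rowg_group (U + Y *m C)%MS.
have fE Y : (rowg_mx (f Y : {set 'rV['F_p]_n}) :=: U + Y *m C)%MS.
  exact: rowgK.
have dimf Y : sub_dim (f Y) = (sub_dim G + \rank Y)%N.
  rewrite /sub_dim fE addsmxC mxrank_disjoint_sum.
    by rewrite mxrankMfree // addnC.
  apply/eqP; rewrite -submx0 -CU0; apply: capmxS => //; exact: submxMl.
rewrite /gauss_binom -(@eq_card_imset _ _ _ f).
  apply: eq_card => X; rewrite inE; apply/and3P/imsetP => [[GX XH]|[Y]].
    move=> /eqP dX; pose V := rowg_mx (X : {set 'rV['F_p]_n}).
    pose Y := (<<(V :&: C) *m pinvmx C>>)%MS.
    have YC : (Y *m C :=: (V :&: C))%MS.
      apply: eqmx_trans (eqmxMr _ (genmxE _)) _.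
      by rewrite mulmxKpV ?capmxSr.
    have fY : f Y = X.
      apply: val_inj; rewrite /= -[RHS]rowg_mxK; apply: eq_rowg.
      apply: eqmx_trans (adds_eqmx (eqmx_refl _) YC) _.
      rewrite capmxC; apply: eqmx_trans (matrix_modl _ _) _.
        by rewrite -sub_leE.
      apply: eqmx_trans (cap_eqmx UCW (eqmx_refl _)) _.
      by apply/capmx_idPr; rewrite -sub_leE.
    exists Y => //; rewrite inE -(eqn_add2l (sub_dim G)) -dimf fY dX //.
  rewrite inE => /eqP rY ->; rewrite !sub_leE dimf rY eqxx !fE; split=> //.
    exact: addsmxSl.
  by rewrite -UCW addsmxS // submxMl.
move=> Y Z _ _.
have sub Y' Z' : (U + Y' *m C <= U + Z' *m C)%MS = (Y' <= Z')%MS.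
  apply/idP/idP => [YZ|YZ]; last by rewrite addsmxS // submxMr.
  rewrite -(submxMfree _ _ Cfree).
  have : (Y' *m C <= (U + Z' *m C) :&: C)%MS.
    by rewrite sub_capmx submxMl (submx_trans _ YZ) // addsmxSr.
  rewrite addsmxC -(matrix_modl _ (submxMl _ _)) capmxC CU0 => /submx_trans.
  by apply; rewrite addsmx_sub submx_refl sub0mx.
split=> [E|/rowg_eqP].
  apply/rowg_eqP; rewrite -!sub; apply/eqmxP; apply: eqmx_trans (eqmx_sym (fE _)) _.
  rewrite E; exact: fE.
rewrite -!sub => /eqmxP/eq_rowg E; apply: val_inj; exact: E.
Qed.

End Subspaces.

(** * Size of Gaussian binomial coefficients *)

Section GaussBinomial.
Variable p : nat.

Lemma gauss_binom_row_free m k :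
  gauss_binom p m k = #|[set rowg B | B : 'M['F_p]_(k, m) & row_free B]|.
Proof.
congr #|pred_of_set _|; apply/setP => W; apply/imsetP/imsetP => -[A].
  rewrite inE => /eqP rA ->.
  exists (castmx (rA, erefl m) (row_base A)).
    by rewrite inE /row_free eqmx_cast eq_row_base rA.
  by apply: eq_rowg; apply/eqmx_sym/(eqmx_trans (eqmx_cast _ _))/eq_row_base.
rewrite inE => /eqP rA ->; exists <<A>>%MS; first by rewrite inE genmxE rA.
exact/eq_rowg/eqmx_sym/genmxE.
Qed.

(** GL_k acts simply transitively on the bases of a k-dimensional space. *)
Lemma gauss_binom_card_row_free m k :
  (gauss_binom p m k * #|[set g : 'M['F_p]_k | g \in unitmx]| =
   #|[set B : 'M['F_p]_(k, m) | row_free B]|)%N.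
Proof.
rewrite gauss_binom_row_free; set D := [set B | row_free B].
rewrite -[RHS]sum1_card (partition_big_imset (fun B => rowg B)) /=.
rewrite -sum_nat_const; apply: eq_bigr => _ /imsetP[B BD ->].
rewrite sum1dep_card; move: BD; rewrite inE => Bfree.
rewrite -(card_in_imset (f := fun g => (g *m B)%R)); last first.
  move=> g h _ _ E. apply: (row_free_inj Bfree E).
apply: eq_card => C; rewrite !inE; apply/imsetP/andP => [[g]|[Cfree CB]].
  rewrite inE => gU ->; split.
    by rewrite /row_free mxrankMfree // mxrank_unit.
  by apply/eqP/rowg_eqP/eqmxMunitP; exists g.
have /eqmxMunitP[g gU ->] : (C == B)%MS by apply/rowg_eqP/eqP.
by exists g; rewrite ?inE.
Qed.

Hypothesis p_pr : prime p.
Local Open Scope ring_scope.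

(** The row spaces of the matrices (1 | M) are pairwise distinct. *)
Lemma gauss_binom_ge k l : (p ^ (k * l) <= gauss_binom p (k + l) k)%N.
Proof.
pose f (M : 'M['F_p]_(k, l)) := rowg (row_mx 1%:M M).
rewrite -{1}(card_Fp p_pr) -card_mx -cardsT.
rewrite -(card_in_imset (f := f)); last first.
  move=> M M' _ _ /rowg_eqP/eqmxMunitP[g _].
  by rewrite mul_mx_row mulmx1 => /eq_row_mx[<-]; rewrite mul1mx.
rewrite gauss_binom_row_free; apply/subset_leq_card/fintype.subsetP => _ /imsetP[M _ ->].
apply: imset_f; rewrite inE; apply/row_freeP; exists (col_mx 1%:M 0).
by rewrite mul_row_col mulmx1 mulmx0 addr0.
Qed.

(** Each factor of |GL_k| = p^(k choose 2) (p - 1) ... (p^k - 1) is at least half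
    of the corresponding power of p. *)
Lemma card_unitmx_ge k :
  (p ^ (k * k) <= 2 ^ k * #|[set g : 'M['F_p]_k | g \in unitmx]|)%N.
Proof.
case: k => [|k].
  rewrite mul1n; apply/card_gt0P; exists 1%:M; by rewrite inE unitmx1.
have -> : #|[set g : 'M['F_p]_k.+1 | g \in unitmx]| = #|'GL_k.+1['F_p]%g|.
  by rewrite cardsT /= card_sub cardsE.
rewrite card_GL // card_Fp // -bin2_sum expn_sum mulnCA -expn_sum.
have -> : (2 ^ k.+1 = \prod_(1 <= i < k.+2) 2)%N.
  by rewrite prod_nat_const_nat subn1.
rewrite -big_split /= bin2_sum.
apply: (@leq_trans (p ^ 'C(k.+1, 2) * \prod_(1 <= i < k.+2) p ^ i)%N).
  rewrite -expn_sum -expnD leq_exp2l ?prime_gt1 //.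
  have -> : (\sum_(1 <= i < k.+2) i = 'C(k.+2, 2))%N.
    by rewrite -bin2_sum [RHS]big_ltn.
  rewrite (binS k.+1) bin1; suff : (2 * 'C(k.+1, 2) + k.+1 = k.+1 * k.+1)%N.
    by rewrite mul2n -addnn -addnA => <-.
  by elim: (k.+1) => // j IHj; rewrite binS bin1; nia.
rewrite leq_mul2l; apply/orP; right.
rewrite big_nat_cond [leqRHS]big_nat_cond; apply: leq_prod => i.
rewrite andbT => /andP[i1 _].
have : (1 < p ^ i)%N by rewrite -{1}(expn0 p) ltn_exp2l // prime_gt1.
by lia.
Qed.

Lemma gauss_binom_le k l : (gauss_binom p (k + l) k <= 2 ^ k * p ^ (k * l))%N.
Proof.
have := gauss_binom_card_row_free (k + l) k.
set u := #|_|; set r := #|_| => E.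
have r_le : (r <= p ^ (k * (k + l)))%N.
  by rewrite -[X in (X ^ _)%N](card_Fp p_pr) -card_mx max_card.
have u_ge : (p ^ (k * k) <= 2 ^ k * u)%N := card_unitmx_ge k.
have p0 : (0 < p ^ (k * k))%N by rewrite expn_gt0 prime_gt0.
rewrite -(leq_pmul2r p0) -mulnA -expnD -mulnDr (addnC l).
apply: leq_trans (leq_mul (leqnn _) u_ge) _.
by rewrite mulnCA E leq_mul2l r_le orbT.
Qed.

Lemma gauss_binom0 m : gauss_binom p m 0 = 1%N.
Proof.
apply/eqP; rewrite eqn_leq.
by have := gauss_binom_le 0 m; have := gauss_binom_ge 0 m => /= -> ->.
Qed.

Lemma gauss_binom_full m : gauss_binom p m m = 1%N.
Proof.
have := gauss_binom_card_row_free m m.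
rewrite [X in _ = X](_ : _ = #|[set g : 'M['F_p]_m | g \in unitmx]|).
  rewrite -[RHS]mul1n => /eqP; rewrite eqn_pmul2r => [/eqP//|].
  by apply/card_gt0P; exists 1%:M; rewrite inE unitmx1.
by apply: eq_card => g; rewrite !inE row_free_unit.
Qed.

Lemma gauss_binom_line m :
  (gauss_binom p m 1 * (p - 1) = p ^ m - 1)%N.
Proof.
have := gauss_binom_card_row_free m 1.
rewrite [X in (_ * X)%N = _](_ : _ = (p - 1)%N); last first.
  have -> : #|[set g : 'M['F_p]_1 | g \in unitmx]| = #|'GL_1['F_p]%g|.
    by rewrite cardsT /= card_sub cardsE.
  by rewrite card_GL_1 card_Fp // subn1.
move=> ->; rewrite -[X in (X ^ _)%N](card_Fp p_pr).
rewrite -[m in (_ ^ m)%N]mul1n -card_mx subn1 -(cardC1 (0 : 'M['F_p]_(1, m))).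
apply: eq_card => B; rewrite !inE /row_free rank_rV.
by case: (B == 0).
Qed.

Lemma gauss_binom21 : gauss_binom p 2 1 = p.+1.
Proof.
have := gauss_binom_line 2; have p1 := prime_gt1 p_pr.
rewrite -(exp1n 2) subn_sqr mulnC addn1 => /eqP.
by rewrite eqn_pmul2l ?subn_gt0 // => /eqP.
Qed.

End GaussBinomial.

(** * The codensity of the lattice of transfer systems of C_p^n *)

Section CodensityFormula.
Variables (R : numFieldType) (p n : nat).
Local Open Scope ring_scope.

(** The number of unlifted squares of subspaces of F_p^n. *)
Definition escape_sum : R :=
  \sum_(0 <= i < n) \sum_(1 <= j < (n - i).+1)
    \sum_(0 <= k < (n - i - j).+1)
      (gauss_binom p n i)%:R * (gauss_binom p (n - i) j)%:R
        * (gauss_binom p (n - i - j) k)%:R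
        * ((num_subspaces p (j + k))%:R - (num_subspaces p k)%:R).

(** The number of pairs of subspaces x < y of F_p^n. *)
Definition flag_sum : R :=
  \sum_(0 <= i < n)
    (gauss_binom p n i)%:R * ((num_subspaces p (n - i))%:R - 1).

Lemma codensity_elem_abelian :
  codensity (Tr (Subgroups (elem_abelian p n))) R = escape_sum / flag_sum ^+ 2.
Proof.
rewrite codensity_Tr /escape_sum /flag_sum.
rewrite (@card_unlifted_squares _ _ R (@sub_dim p n) (gauss_binom p)
  (@sub_dim_lt p n) (sub_dim_bot p n) (@card_sub_interval p n)).
rewrite (@card_strict_pairs _ _ R (@sub_dim p n) (gauss_binom p)
  (@sub_dim_lt p n) (sub_dim_bot p n) (@card_sub_interval p n)).
by rewrite sub_dim_top.
Qed.

End CodensityFormula.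

Section Estimates.
Variable p : nat.
Hypothesis p_pr : prime p.

Lemma num_subspaces_le m : (num_subspaces p m <= 4 ^ m * p ^ (m * m %/ 4))%N.
Proof.
apply: (@leq_trans (\sum_(0 <= e < m.+1) 2 ^ m * p ^ (m * m %/ 4))%N).
  rewrite /num_subspaces big_nat_cond [leqRHS]big_nat_cond.
  apply: leq_sum => e; rewrite andbT ltnS => /= em.
  have := gauss_binom_le p_pr e (m - e); rewrite subnKC // => /leq_trans; apply.
  apply: leq_mul; first by rewrite leq_exp2l.
  rewrite leq_exp2l ?prime_gt1 //; move: (m - e)%N (subnKC em) => f <-.
  by rewrite leq_divRL // mulnC mulnn nat_AGM2.
rewrite sum_nat_const_nat subn0 mulnA leq_mul2r; apply/orP; right.
by rewrite (expnMn 2 2) leq_mul2r ltn_expl ?orbT.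
Qed.

(** With m = j + k, the exponent of p in the product of the bounds is
    i (m + l) + m l + j k + floor(m^2/4), and j k <= m^2/4, so twice it is at
    most (i + m + l)^2 = n^2. *)
Lemma escape_term_le n i j k l : n = (i + (j + (k + l)))%N ->
  (gauss_binom p n i * gauss_binom p (n - i) j * gauss_binom p (n - i - j) k
     * num_subspaces p (j + k) <= 8 ^ n * p ^ (n * n %/ 2))%N.
Proof.
move=> nE; rewrite [in leqLHS]nE !addKn.
apply: leq_trans (leq_mul (leq_mul (leq_mul (gauss_binom_le p_pr _ _)
  (gauss_binom_le p_pr _ _)) (gauss_binom_le p_pr _ _)) (num_subspaces_le _)) _.
rewrite [leqLHS](_ : _ = (2 ^ (i + j + k + 2 * (j + k))) *
  p ^ (i * (j + (k + l)) + j * (k + l) + k * l + (j + k) * (j + k) %/ 4))%N.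
  rewrite leq_mul //; first by rewrite -[8%N]/(2 ^ 3)%N -expnM leq_exp2l //; lia.
  rewrite leq_exp2l ?prime_gt1 // leq_divRL //.
  have : (4 * ((j + k) * (j + k) %/ 4) <= (j + k) * (j + k))%N by lia.
  have := (nat_AGM2 j k).1; rewrite -mulnn.
  move: (_ %/ 4)%N => q; rewrite nE; nia.
have -> : (4 ^ (j + k) = 2 ^ (2 * (j + k)))%N by rewrite expnM.
rewrite !(expnD 2) !(expnD p) (mulnACA (2 ^ i)) (mulnACA (2 ^ i * 2 ^ j)).
by rewrite (mulnACA (2 ^ i * 2 ^ j * 2 ^ k)).
Qed.

Lemma gauss_binom_lt_num_subspaces m j : (0 < j <= m)%N ->
  (gauss_binom p m j < num_subspaces p m)%N.
Proof.
move=> /andP[j0 jm]; rewrite /num_subspaces big_ltn // gauss_binom0 //.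
rewrite (bigD1_seq j) ?iota_uniq ?mem_index_iota ?j0 //= addnA.
by apply: leq_addr.
Qed.

Variable R : realFieldType.
Local Open Scope ring_scope.

Lemma num_subspaces_gt0 m : (0 < num_subspaces p m)%N.
Proof. by rewrite /num_subspaces big_ltn // gauss_binom0. Qed.

(** The subspaces x of dimension i and y of dimension i + j alone give at
    least this many pairs x < y. *)
Lemma flag_sum_ge n i j l : n = (i + (j + l))%N -> (0 < j)%N ->
  (p ^ (i * (j + l) + j * l))%:R <= flag_sum R p n.
Proof.
move=> nE j0; rewrite /flag_sum.
have i_in : i \in index_iota 0 n by rewrite mem_index_iota; lia.
rewrite (bigD1_seq i) ?iota_uniq //= -[leLHS]addr0; apply: lerD; last first.
  apply: sumr_ge0 => e _; rewrite mulr_ge0 ?ler0n // subr_ge0.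
  by rewrite ler1n num_subspaces_gt0.
rewrite expnD natrM; apply: ler_pM; rewrite ?ler0n //.
  by rewrite nE ler_nat gauss_binom_ge.
rewrite lerBrDr natr1 ler_nat nE addKn.
apply: leq_ltn_trans (gauss_binom_ge p_pr j l) _.
by apply: gauss_binom_lt_num_subspaces; rewrite j0 leq_addr.
Qed.

Lemma ler_sum_nat_const (F : nat -> R) m n (c : R) :
  (forall i, (m <= i < n)%N -> F i <= c) ->
  \sum_(m <= i < n) F i <= c *+ (n - m).
Proof.
by move=> Fc; rewrite -sumr_const_nat; apply: ler_sum_nat.
Qed.

Lemma escape_sum_le n : escape_sum R p n <= (64 ^ n * p ^ (n * n %/ 2))%:R.
Proof.
(* Each of the three sums has at most n terms, and n^3 <= 8^n. *)
pose T : R := (8 ^ n * p ^ (n * n %/ 2))%:R.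
have T0 : 0 <= T by exact: ler0n.
have n2 : (n <= 2 ^ n)%N by rewrite ltnW // ltn_expl.
apply: (@le_trans _ _ (T *+ n *+ n *+ n)); last first.
  rewrite /T -!mulrnA ler_nat (expnMn 8 8) -!mulnA leq_mul2l; apply/orP; right.
  rewrite mulnC leq_mul2r; apply/orP; right.
  by rewrite (expnMn 2 4) (expnMn 2 2) !leq_mul.
have mulrn_le (x : R) a b : 0 <= x -> (a <= b)%N -> x *+ a <= x *+ b.
  by move=> x0 ab; rewrite ler_wpMn2l.
rewrite /escape_sum -[X in _ <= _ *+ X](subn0 n).
apply: ler_sum_nat_const => i /andP[_ ilt].
apply: le_trans (mulrn_le _ (n - i).+1.-1 _ _ _); rewrite ?mulrn_wge0 ?leq_subr //.
rewrite -subn1; apply: ler_sum_nat_const => j /andP[j0 jle].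
apply: le_trans (mulrn_le _ (n - i - j).+1 _ _ _) => //; last by lia.
rewrite -[X in _ <= _ *+ X]subn0; apply: ler_sum_nat_const => k /andP[_ kle].
pose l := (n - i - j - k)%N.
have nE : n = (i + (j + (k + l)))%N by rewrite /l; lia.
have := escape_term_le nE; rewrite -(ler_nat R); apply: le_trans.
rewrite !natrM ler_wpM2l ?mulr_ge0 ?ler0n // lerBlDr lerDl ler0n //.
Qed.

(** The number i j + i l + j l is largest when the parts of n are nearly equal,
    and is then floor(n^2/3). *)
Lemma balanced_parts n : (0 < n)%N ->
  exists i j l, [/\ n = (i + (j + l))%N, (0 < j)%N &
    (n * n <= 3 * (i * (j + l) + j * l) + 1)%N].
Proof.
move=> n0; exists (n %/ 3)%N, (n.+2 %/ 3)%N, (n.+1 %/ 3)%N.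
split; [lia|lia|].
have [q [r [r3 nE]]] : exists q r, (r < 3)%N /\ n = (q * 3 + r)%N.
  by exists (n %/ 3)%N, (n %% 3)%N; rewrite ltn_pmod // -divn_eq.
case: r r3 nE => [|[|[|//]]] _ nE.
- have [-> -> ->] : [/\ n %/ 3 = q, n.+2 %/ 3 = q & n.+1 %/ 3 = q]%N.
    by split; lia.
  by nia.
- have [-> -> ->] : [/\ n %/ 3 = q, n.+2 %/ 3 = q.+1 & n.+1 %/ 3 = q]%N.
    by split; lia.
  by nia.
- have [-> -> ->] : [/\ n %/ 3 = q, n.+2 %/ 3 = q.+1 & n.+1 %/ 3 = q.+1]%N.
    by split; lia.
  by nia.
Qed.

(** The exponent comes from
    floor(n^2/2) + floor(n^2/6) <= 2 floor(n^2/3), valid because n^2 is 0 or 1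
    modulo 3. *)
Lemma codensity_le n : (0 < n)%N ->
  codensity (Tr (Subgroups (elem_abelian p n))) R <=
  64 ^+ n / p%:R ^+ (n * n %/ 6).
Proof.
move=> n0; rewrite codensity_elem_abelian.
have [i [j [l [nE j0 nn]]]] := balanced_parts n0.
have p0 : 0 < p%:R :> R by rewrite ltr0n prime_gt0.
have := flag_sum_ge nE j0.
set e := (i * _ + _)%N in nn * => D_ge.
have D_gt0 : 0 < flag_sum R p n.
  by apply: lt_le_trans D_ge; rewrite natrX exprn_gt0.
rewrite ler_pdivrMr ?exprn_gt0 //; apply: le_trans (escape_sum_le n) _.
rewrite mulrAC ler_pdivlMr ?exprn_gt0 // natrM !natrX -mulrA -exprD.
rewrite ler_wpM2l ?exprn_ge0 //.
apply: (@le_trans _ _ (p%:R ^+ e ^+ 2)).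
  by rewrite -exprM ler_eXn2l ?ltr1n ?prime_gt1 //; lia.
by rewrite -natrX; apply: lerXn2r => //; rewrite ?nnegrE ?ler0n ?(ltW D_gt0).
Qed.

Lemma codensity_ge0 n :
  0 <= codensity (Tr (Subgroups (elem_abelian p n))) R.
Proof. by rewrite /codensity divr_ge0 // ?mulr_ge0 // ler0n. Qed.

Lemma num_subspaces0 : num_subspaces p 0 = 1%N.
Proof. by rewrite /num_subspaces unlock /= gauss_binom0. Qed.

Lemma num_subspaces1 : num_subspaces p 1 = 2%N.
Proof. by rewrite /num_subspaces unlock /= gauss_binom0 // gauss_binom_full. Qed.

Lemma num_subspaces2 : num_subspaces p 2 = (p + 3)%N.
Proof.
rewrite /num_subspaces unlock /= gauss_binom0 // gauss_binom_full //.
by rewrite gauss_binom21 //; lia.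
Qed.

Lemma codensity1 : codensity (Tr (Subgroups (elem_abelian p 1))) R = 1.
Proof.
rewrite codensity_elem_abelian /escape_sum /flag_sum unlock /=.
rewrite addn0 !subn0 subnn !gauss_binom0 // gauss_binom_full //.
rewrite num_subspaces0 num_subspaces1.
by field.
Qed.

Lemma codensity2 : codensity (Tr (Subgroups (elem_abelian p 2))) R =
  (p%:R ^+ 2 + 5 * p%:R + 5) / (2 * p%:R + 3) ^+ 2.
Proof.
rewrite codensity_elem_abelian /escape_sum /flag_sum unlock /=.
rewrite !subn0 (_ : 2 - 1 = 1)%N // !subnn !(addn0, add0n) (_ : 1 + 1 = 2)%N //.
rewrite !gauss_binom0 // !gauss_binom_full // gauss_binom21 //.
rewrite num_subspaces0 num_subspaces1 num_subspaces2 natrD -natr1.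
congr (_ / _); ring.
Qed.

End Estimates.

(** * Limits *)

Local Open Scope classical_set_scope.
Local Open Scope ring_scope.

Section Limits.
Variable R : realType.

Lemma cvg_inv_primes (c : R) :
  c / p%:R @[p --> within [set p : nat | prime p] \oo] --> (0 : R).
Proof.
apply: cvg_within_filter.
suff inv0 : p%:R^-1 @[p --> \oo] --> (0 : R).
  by have := cvgM (cvg_cst c) inv0; rewrite mulr0; apply.
apply/(gtr0_cvgV0 (f := fun p : nat => p%:R : R)); last exact: cvgr_idn.
by near=> p; rewrite ltr0n; near: p; exists 1%N.
Unshelve. all: by end_near.
Qed.

(** By [codensity2] the excess over 1/4 is (8 p + 11) / (4 (2 p + 3)^2), which
    lies between 0 and 1/p. *)
Lemma codensity2_bounds p : prime p ->
  4^-1 <= codensity (Tr (Subgroups (elem_abelian p 2))) R <= 4^-1 + 1 / p%:R.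
Proof.
move=> p_pr; rewrite codensity2 //; have : 0 < p%:R :> R by rewrite ltr0n prime_gt0.
move: (p%:R) => x x0; have D0 : 0 < (2 * x + 3) ^+ 2 by rewrite exprn_gt0; lra.
apply/andP; split; first by rewrite ler_pdivlMr //; nra.
rewrite ler_pdivrMr //.
have -> : (4^-1 + 1 / x) * (2 * x + 3) ^+ 2 =
   x ^+ 2 + 5 * x + 5 + (8 * x ^+ 2 + 37 * x + 36) / (4 * x).
  by field; rewrite gt_eqF.
rewrite lerDl divr_ge0 //; nra.
Qed.

Lemma cvg_codensity_p n : (0 < n)%N ->
  codensity (Tr (Subgroups (elem_abelian p n))) R
    @[p --> within [set p : nat | prime p] \oo]
    --> (if n == 1%N then 1 else if n == 2%N then 4^-1 else 0 : R).
Proof.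
move=> n0; have [n1|n1] := eqVneq n 1%N.
  rewrite n1; apply: (@squeeze_cvgr _ _ _ _ (fun=> 1) (fun=> 1)).
  - by near=> p; rewrite codensity1 ?lexx //; near: p; exact: withinT.
  - exact: cvg_cst.
  - exact: cvg_cst.
have [n2|n2] := eqVneq n 2%N.
  rewrite n2; apply: (@squeeze_cvgr _ _ _ _ (fun=> 4^-1) (fun p => 4^-1 + 1 / p%:R)).
  - by near=> p; apply: codensity2_bounds; near: p; exact: withinT.
  - exact: cvg_cst.
  - rewrite -[X in _ --> X]addr0; apply: cvgD; first exact: cvg_cst.
    exact: cvg_inv_primes.
apply: (@squeeze_cvgr _ _ _ _ (fun=> 0) (fun p => 64 ^+ n / p%:R)).
- near=> p; have p_pr : prime p by near: p; exact: withinT.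
  rewrite codensity_ge0 //=; apply: le_trans (codensity_le p_pr R n0) _.
  rewrite ler_pM2l ?exprn_gt0 // lef_pV2 ?posrE ?exprn_gt0 ?ltr0n ?prime_gt0 //.
  rewrite -[leLHS]expr1; apply: ler_weXn2l.
    by rewrite ler1n prime_gt0.
  rewrite leq_divRL //.
  have n3 : (3 <= n)%N by lia.
  by apply: leq_trans (leq_mul n3 n3).
- exact: cvg_cst.
- exact: cvg_inv_primes.
Unshelve. all: by end_near.
Qed.

Lemma cvg_codensity_n p : prime p ->
  codensity (Tr (Subgroups (elem_abelian p n))) R @[n --> \oo] --> (0 : R).
Proof.
move=> p_pr; apply: (@squeeze_cvgr _ _ _ _ (fun=> 0) (fun n => 2^-1 ^+ n)).
- near=> n; rewrite codensity_ge0 //=.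
  (* From n >= 43 on, floor(n^2/6) >= 7 n, so the bound is at most
     64^n / 2^(7 n) = 2^-n. *)
  have n43 : (43 <= n)%N by near: n; exists 43%N.
  have n0 : (0 < n)%N by lia.
  apply: le_trans (codensity_le p_pr R n0) _.
  rewrite ler_pdivrMr ?exprn_gt0 ?ltr0n ?prime_gt0 //.
  rewrite exprVn mulrC ler_pdivlMr ?exprn_gt0 // -exprMn.
  apply: (@le_trans _ _ (2 ^+ (n * n %/ 6))).
    rewrite [leLHS](_ : _ = 2 ^+ (7 * n)); last by rewrite exprM; congr (_ ^+ _); ring.
    by apply: ler_weXn2l; rewrite ?ler1n // leq_divRL //; nia.
  by apply: lerXn2r; rewrite ?nnegrE ?ler0n // ler_nat prime_gt1.
- exact: cvg_cst.
- by apply: cvg_expr; rewrite ger0_norm; lra.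
Unshelve. all: by end_near.
Qed.

End Limits.

Theorem theorem4 (R : realType) :
  [/\ forall p n : nat, prime p -> (0 < n)%N ->
        codensity (Tr (Subgroups (elem_abelian p n))) R =
        (\sum_(0 <= i < n) \sum_(1 <= j < (n - i).+1)
           \sum_(0 <= k < (n - i - j).+1)
             (gauss_binom p n i)%:R * (gauss_binom p (n - i) j)%:R
               * (gauss_binom p (n - i - j) k)%:R
               * ((num_subspaces p (j + k))%:R - (num_subspaces p k)%:R))
        / (\sum_(0 <= i < n)
             (gauss_binom p n i)%:R * ((num_subspaces p (n - i))%:R - 1)) ^+ 2,
      forall n : nat, (0 < n)%N ->
        codensity (Tr (Subgroups (elem_abelian p n))) R
          @[p --> within [set p : nat | prime p] \oo]
          --> (if n == 1%N then 1 else if n == 2%N then 4^-1 else 0 : R) &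
      forall p : nat, prime p ->
        codensity (Tr (Subgroups (elem_abelian p n))) R @[n --> \oo] --> (0 : R)].
Proof.
split; [|exact: cvg_codensity_p|exact: cvg_codensity_n].
by move=> p n _ _; exact: codensity_elem_abelian.
Qed.
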